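(* Let $F$ be a 4-regular graph with $c(F)$ connected components and $n$ vertices. Then there is a matroid $M_{\tau}(F)$ of rank $n$ defined on the set $\mathfrak{T}(F)$ of transitions of $F$ such that for every circuit partition $P$ of $F$, the rank of $\tau(P)$ in $M_{\tau}(F)$ is \[ r(\tau(P)) = n + c(F) - |P|, \] where $|P|$ is the number of circuits in $P$.
   Context: Graphs are finite and may have loops and multiple edges. Each edge consists of two distinct half-edges, each incident on exactly one vertex (both half-edges of a loop are incident on the same vertex). A graph is 4-regular if every vertex has exactly four incident half-edges. A circuit in a graph is a sequence $v_1,h_1,h_1',v_2,h_2,h_2',\dots,v_k,h_k,h_k'=h_0',v_{k+1}=v_1$ such that for each $i\in\{1,\dots,k\}$, $h_i$ and $h_i'$ are the two half-edges of a single edge and $h_{i-1}'$ and $h_i$ are both incident on $v_i$; the half-edges appearing must be pairwise distinct (vertices may repeat). Two circuits are the same if they differ by cyclic permutations and reversals. A circuit partition of $F$ is a partition of $E(F)$ into the edge sets of edge-disjoint circuits. A transition at a vertex $v$ is a partition of the four half-edges incident on $v$ into two pairs; there are three transitions at each vertex, and $\mathfrak{T}(F)$ denotes the set of all transitions of $F$. Each passage $h_{i-1}',v_i,h_i$ of a circuit through a vertex pairs two half-edges at $v_i$; the two passages through $v$ made by the circuits of a circuit partition $P$ form a transition at $v$. $\tau(P)\subseteq\mathfrak{T}(F)$ denotes the set of transitions used by $P$, one at each vertex; $\tau$ is a bijection from circuit partitions of $F$ onto the sets containing exactly one transition at each vertex. *)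

(* Defs.v *)
From HB Require Import structures.
From mathcomp Require Import all_boot all_order all_algebra.

Set Implicit Arguments.
Unset Strict Implicit.
Unset Printing Implicit Defensive.

(* Graphs as half-edge structures: [twin] exchanges the two half-edges of an
   edge, so loops and multiple edges are allowed. *)
Record graph := Graph {
  vertex : finType;
  half_edge : finType;
  inc : half_edge -> vertex;
  twin : half_edge -> half_edge;
  twinK : involutive twin;
  twin_neq : forall h, twin h != h
}.

Arguments inc {g} _.
Arguments twin {g} _.

Section Graph.
Variable F : graph.
Implicit Types (v : vertex F) (h : half_edge F) (s t : seq (half_edge F)).

Definition star v : {set half_edge F} := [set h | inc h == v].

Definition four_regular : Prop := forall v, #|star v| = 4.

Definition edge_of h : {set half_edge F} := [set h; twin h].

Definition edges : {set {set half_edge F}} := [set edge_of h | h : half_edge F].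

Definition adj : rel (vertex F) :=
  fun u v => [exists h, (inc h == u) && (inc (twin h) == v)].

Lemma adj_sym : symmetric adj.
Proof.
by move=> u v; apply/existsP/existsP => -[h /andP[hu hv]]; exists (twin h);
  rewrite twinK hu hv.
Qed.

Definition num_components : nat := n_comp adj (vertex F).

Definition transitions_at v : {set {set {set half_edge F}}} :=
  [set T | partition T (star v) & [forall p in T, #|p| == 2]].

Definition transitions : {set {set {set half_edge F}}} :=
  \bigcup_v transitions_at v.

(* The list [:: h_1; ...; h_k] stands for v_1, h_1, h_1', ..., v_k, h_k, h_k',
   v_1: here h_i' = twin h_i and v_i = inc h_i are determined by h_i. *)
Definition is_circuit s : bool :=
  [&& s != [::],
      cycle (fun h g => inc (twin h) == inc g) s
    & uniq (s ++ map twin s)].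

(* Traversed backwards, an edge is entered through its other half-edge. *)
Definition reversal s := rev (map twin s).

Definition rotation_of s t : bool :=
  has (fun k => t == rot k s) (iota 0 (size s).+1).

Definition same_circuit s t : bool :=
  rotation_of s t || rotation_of (reversal s) t.

Lemma rotation_ofP s t : reflect (exists k, t = rot k s) (rotation_of s t).
Proof.
apply: (iffP hasP) => [[k _ /eqP ->]|[k ->]]; first by exists k.
have [le_ks | lt_sk] := leqP k (size s).
  by exists k => //; rewrite mem_iota.
by exists 0; [rewrite mem_iota | rewrite rot0 rot_oversize // ltnW].
Qed.

Lemma reversalK : involutive reversal.
Proof.
by move=> s; rewrite /reversal map_rev revK mapK //; exact: twinK.
Qed.

Lemma reversal_rot k s : exists j, reversal (rot k s) = rot j (reversal s).
Proof.
exists (size (rev (map twin s)) - k).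
by rewrite /reversal map_rot rev_rot.
Qed.

Lemma rotation_refl : reflexive rotation_of.
Proof. by move=> s; apply/rotation_ofP; exists 0; rewrite rot0. Qed.

Lemma rotation_sym : symmetric rotation_of.
Proof.
suff sub s t : rotation_of s t -> rotation_of t s.
  by move=> s t; apply/idP/idP; apply: sub.
move=> /rotation_ofP[k ->]; apply/rotation_ofP.
by exists (size (rot k s) - k); rewrite -[RHS]/(rotr k (rot k s)) rotK.
Qed.

Lemma rotation_trans : transitive rotation_of.
Proof.
move=> t s u /rotation_ofP[k ->] /rotation_ofP[j ->]; apply/rotation_ofP.
have [le_ks | lt_sk] := leqP k (size s); last first.
  by exists j; rewrite [rot k s]rot_oversize // ltnW.
have [le_js | lt_sj] := leqP j (size s); last first.
  by exists k; rewrite rot_oversize // size_rot ltnW.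
by rewrite rot_add_mod //; eexists.
Qed.

Lemma rotation_reversal s t :
  rotation_of s t -> rotation_of (reversal s) (reversal t).
Proof.
by move=> /rotation_ofP[k ->]; have [j ->] := reversal_rot k s;
  apply/rotation_ofP; exists j.
Qed.

Lemma rotation_reversal_swap s t :
  rotation_of (reversal s) t = rotation_of s (reversal t).
Proof.
by apply/idP/idP => /rotation_reversal; rewrite reversalK.
Qed.

Lemma same_circuit_refl : reflexive same_circuit.
Proof. by move=> s; rewrite /same_circuit rotation_refl. Qed.

Lemma same_circuit_sym : symmetric same_circuit.
Proof.
by move=> s t; rewrite /same_circuit rotation_sym rotation_reversal_swap
  [rotation_of s _]rotation_sym.
Qed.

Lemma same_circuit_trans : transitive same_circuit.
Proof.
move=> t s u /orP[] st /orP[] tu; apply/orP.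
- by left; apply: rotation_trans tu.
- by right; apply: rotation_trans tu; apply: rotation_reversal.
- by right; apply: rotation_trans tu.
- left; apply: rotation_trans tu.
  by move: st; rewrite rotation_reversal_swap.
Qed.

Lemma size_is_circuit s : is_circuit s -> size s <= #|half_edge F|.
Proof.
case/and3P=> _ _; rewrite cat_uniq => /and3P[/card_uniqP <- _ _].
exact: max_card.
Qed.

(* By [size_is_circuit] the length bound of [bseq] is not a restriction; it
   makes the type finite. *)
Definition circuit_seq :=
  {s : #|half_edge F|.-bseq (half_edge F) | is_circuit s}.

Definition same_circuit_seq : rel circuit_seq :=
  fun x y => same_circuit (val x) (val y).

Lemma same_circuit_seq_refl : reflexive same_circuit_seq.
Proof. by move=> s; exact: same_circuit_refl. Qed.

Lemma same_circuit_seq_sym : symmetric same_circuit_seq.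
Proof. by move=> s t; exact: same_circuit_sym. Qed.

Lemma same_circuit_seq_trans : transitive same_circuit_seq.
Proof. by move=> t s u; exact: same_circuit_trans. Qed.

Canonical same_circuit_equiv :=
  EquivRel same_circuit_seq
    same_circuit_seq_refl same_circuit_seq_sym same_circuit_seq_trans.

Definition circuit : Type := {eq_quot same_circuit_seq}%qT.

HB.instance Definition _ := Choice.on circuit.
HB.instance Definition _ := EqQuotient.on circuit.

Lemma circuit_reprK : cancel (@repr _ circuit) (\pi_circuit)%qT.
Proof. exact: reprK. Qed.

HB.instance Definition _ : isCountable circuit := CanIsCountable circuit_reprK.
HB.instance Definition _ : isFinite circuit := CanIsFinite circuit_reprK.

Definition seq_edges s : {set {set half_edge F}} := [set edge_of h | h in s].

(* The passage h_{i-1}', v_i, h_i is recorded as the pair {h_{i-1}', h_i}. *)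
Definition seq_passages s : {set {set half_edge F}} :=
  [set [set twin h; next s h] | h in s].

(* The choice of [repr C] is immaterial, see [circuit_edges_pi] and
   [circuit_passages_pi]. *)
Definition circuit_edges (C : circuit) := seq_edges (val (repr C)).

Definition circuit_passages (C : circuit) := seq_passages (val (repr C)).

Lemma seq_edges_same s t : same_circuit s t -> seq_edges s = seq_edges t.
Proof.
suff rotE r u : rotation_of r u -> seq_edges r = seq_edges u.
  have revE : seq_edges (reversal s) = seq_edges s.
    apply/setP => e; apply/imsetP/imsetP => -[h hs ->]; exists (twin h).
    - by move: hs; rewrite mem_rev => /mapP[g gs ->]; rewrite twinK.
    - by rewrite /edge_of twinK setUC.
    - by rewrite mem_rev map_f.
    - by rewrite /edge_of twinK setUC.
  by case/orP => /rotE <-.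
move=> /rotation_ofP[k ->]; apply/setP => e.
by apply/imsetP/imsetP => -[h hs ->]; exists h; move: hs; rewrite ?mem_rot.
Qed.

Lemma seq_passages_same s t :
  is_circuit s -> same_circuit s t -> seq_passages s = seq_passages t.
Proof.
move=> /and3P[_ _]; rewrite cat_uniq => /and3P[Us _ Uts].
suff rotE r u : uniq r -> rotation_of r u -> seq_passages r = seq_passages u.
  have revE : seq_passages (reversal s) = seq_passages s.
    have nextE g : next (reversal s) (twin g) = twin (prev s g).
      by rewrite next_rev // prev_map //; exact: (can_inj (@twinK F)).
    apply/setP => p; apply/imsetP/imsetP => -[h hs ->].
    - move: hs; rewrite mem_rev => /mapP[g gs ->]; exists (prev s g).
        by rewrite mem_prev.
      by rewrite twinK nextE next_prev // setUC.
    - exists (twin (next s h)); first by rewrite mem_rev map_f ?mem_next.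
      by rewrite twinK nextE prev_next // setUC.
  case/orP => st; first exact: rotE.
  by rewrite -revE; apply: rotE; rewrite ?rev_uniq.
move=> Ur /rotation_ofP[k ->]; apply/setP => p.
by apply/imsetP/imsetP => -[h hs ->]; exists h; rewrite ?next_rot //;
  move: hs; rewrite mem_rot.
Qed.

Lemma repr_pi_same (x : circuit_seq) :
  same_circuit (val (repr (\pi_circuit x)%qT)) (val x).
Proof.
change (is_true (same_circuit_equiv (repr (\pi_circuit x)%qT) x)).
by apply/eqmodP; rewrite reprK.
Qed.

Lemma circuit_edges_pi (x : circuit_seq) :
  circuit_edges (\pi_circuit x)%qT = seq_edges (val x).
Proof. exact: seq_edges_same (repr_pi_same x). Qed.

Lemma circuit_passages_pi (x : circuit_seq) :
  circuit_passages (\pi_circuit x)%qT = seq_passages (val x).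
Proof.
exact: (seq_passages_same (svalP (repr (\pi_circuit x)%qT)) (repr_pi_same x)).
Qed.

Definition circuit_partition (P : {set circuit}) : Prop :=
  partition [set circuit_edges C | C in P] edges /\
  {in P &, forall C D, C != D -> [disjoint circuit_edges C & circuit_edges D]}.

Definition transition_used (P : {set circuit}) v : {set {set half_edge F}} :=
  [set p in \bigcup_(C in P) circuit_passages C | p \subset star v].

Definition tau (P : {set circuit}) : {set {set {set half_edge F}}} :=
  [set transition_used P v | v : vertex F].

End Graph.

Record matroid (T : finType) := Matroid {
  ground : {set T};
  indep : {set {set T}};
  indep_ground : forall I : {set T}, I \in indep -> I \subset ground;
  indep0 : set0 \in indep;
  indep_sub : forall I J : {set T}, J \in indep -> I \subset J -> I \in indep;
  indep_aug : forall I J : {set T},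
    I \in indep -> J \in indep -> #|I| < #|J| ->
    exists2 x, x \in J :\: I & x |: I \in indep
}.

Definition mrank (T : finType) (M : matroid T) (A : {set T}) : nat :=
  \max_(I in indep M | I \subset A) #|I|.

(* Main.v *)
(** Let Z be the F_2-space of edge sets of F having even degree at every vertex,
    written as twin-invariant functions on half-edges with even sum on every
    star; its dimension is n + c(F).  A transition {p, p'} gives the functional
    z |-> sum of z over p, which on Z is also the sum over p', and M_tau(F) is
    the linear matroid of these functionals.  If S contains a transition at each
    vertex, then its functionals vanish simultaneously at z exactly when z is
    constant on the components of the relation generated by "twins" and "paired
    by a transition of S".  For S = tau(P) the components are the circuits of P,
    so the rank is n + c(F) - |P|; for S = T(F) they are the components of F,
    so the rank is n.  Dually, a functional on Z is a row vector modulo the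
    annihilator of Z. *)

Require Import Defs.
From mathcomp Require Import all_boot all_order all_algebra.
From mathcomp Require Import zify.

Set Implicit Arguments.
Unset Strict Implicit.
Unset Printing Implicit Defensive.

Import GRing.Theory.

(** * Vector matroids and their rank function *)

Section VectorMatroid.
Variables (K : fieldType) (T : finType) (m : nat) (f : T -> 'rV[K]_m).
Implicit Types (A B I J : {set T}) (x : T).

Definition span A : 'M[K]_m := (\sum_(x in A) <<f x>>)%MS.

Lemma spanP A n (M : 'M_(n, m)) :
  reflect (forall x, x \in A -> (f x <= M)%MS) (span A <= M)%MS.
Proof. by apply: (iffP sumsmx_subP) => sAM x /sAM; rewrite genmxE. Qed.
Arguments spanP {A n M}.

Lemma span_sup A x : x \in A -> (f x <= span A)%MS.
Proof. by move=> Ax; rewrite (sumsmx_sup x) ?genmxE. Qed.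

Lemma spanS A B : A \subset B -> (span A <= span B)%MS.
Proof. by move=> sAB; apply/spanP => x /(subsetP sAB); apply: span_sup. Qed.

Lemma spanU A B : (span (A :|: B) :=: span A + span B)%MS.
Proof.
apply/eqmxP; rewrite addsmx_sub (spanS (subsetUl A B)) (spanS (subsetUr A B)).
rewrite !andbT; apply/spanP => x; rewrite inE => /orP[] /span_sup fx.
  exact: submx_trans fx (addsmxSl _ _).
exact: submx_trans fx (addsmxSr _ _).
Qed.

Lemma rank_span_le A : \rank (span A) <= #|A|.
Proof.
rewrite /span -sum1_card; elim/big_rec2: _ => [|x M r _ le_Mr].
  by rewrite mxrank0.
apply: leq_trans (mxrank_adds_leqif _ _) _.
by rewrite leq_add // mxrank_gen rank_leq_row.
Qed.

Lemma rank_spanU1 A x :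
  ~~ (f x <= span A)%MS -> \rank (span A) < \rank (span (x |: A)).
Proof.
move=> fx; have sAx : (span A <= span (x |: A))%MS by rewrite spanS ?subsetUr.
rewrite ltn_neqAle mxrankS // andbT (mxrank_leqif_sup sAx); apply: contra fx.
by apply: submx_trans; apply: span_sup; rewrite setU11.
Qed.

(** Equality of rank and cardinality says that the indexed family is linearly independent; two
    indices with equal vectors are dependent. *)
Definition free_subset (G I : {set T}) :=
  (I \subset G) && (\rank (span I) == #|I|).

Lemma free_subset0 G : free_subset G set0.
Proof.
by rewrite /free_subset sub0set cards0 -leqn0 -(cards0 T) rank_span_le.
Qed.

Lemma free_subsetS G I J : free_subset G J -> I \subset J -> free_subset G I.
Proof.
case/andP=> sJG /eqP rJ sIJ; rewrite /free_subset (subset_trans sIJ sJG) /=.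
rewrite eqn_leq rank_span_le -(leq_add2r #|J :\: I|).
have -> : #|I| + #|J :\: I| = #|J|.
  by rewrite -[RHS](cardsID I) (setIidPr sIJ).
have JE : J = I :|: (J :\: I).
  by rewrite setDE setUIr setUCr setIT (setUidPr sIJ).
rewrite -rJ [in X in X <= _]JE spanU.
apply: leq_trans (mxrank_adds_leqif _ _) _.
by rewrite leq_add2l rank_span_le.
Qed.

Lemma free_subsetU1 G I x :
  free_subset G I -> x \in G -> ~~ (f x <= span I)%MS ->
  free_subset G (x |: I).
Proof.
case/andP=> sIG /eqP rI Gx fx; rewrite /free_subset subUset sub1set Gx sIG /=.
rewrite eqn_leq rank_span_le cardsU1.
have -> : x \notin I by apply: contra fx; apply: span_sup.
by rewrite add1n -rI rank_spanU1.
Qed.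

Lemma free_subset_aug G I J :
  free_subset G I -> free_subset G J -> #|I| < #|J| ->
  exists2 x, x \in J :\: I & free_subset G (x |: I).
Proof.
move=> GI GJ ltIJ.
have /subsetPn[x Jx fx] : ~~ (J \subset [set x | (f x <= span I)%MS]).
  apply: contraL ltIJ => /subsetP sJI; rewrite -leqNgt.
  case/andP: GI => _ /eqP <-; case/andP: GJ => _ /eqP <-.
  by rewrite mxrankS //; apply/spanP => x /sJI; rewrite inE.
rewrite inE in fx; exists x.
  by rewrite inE Jx andbT; apply: contra fx; apply: span_sup.
by apply: free_subsetU1 => //; case/andP: GJ => /subsetP->.
Qed.

Definition vector_matroid (G : {set T}) : matroid T.
Proof.
apply: (@Matroid T G [set I | free_subset G I]) => [I|| I J | I J].
- by rewrite inE => /andP[].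
- by rewrite inE free_subset0.
- by rewrite !inE; apply: free_subsetS.
rewrite !inE => GI GJ /(free_subset_aug GI GJ)[x Jx fx].
by exists x => //; rewrite inE.
Defined.

Lemma mrank_vector_matroid (G A : {set T}) :
  A \subset G -> mrank (vector_matroid G) A = \rank (span A).
Proof.
move=> sAG; apply/eqP; rewrite eqn_leq /mrank; apply/andP; split.
  apply/bigmax_leqP => I; rewrite inE => /andP[/andP[_ /eqP <-] sIA].
  by rewrite mxrankS ?spanS.
(* A maximal independent subset of [A] spans [A], since any vector outside its span could be added
   to it. *)
have [|I] := @ex_maxset T [pred I | free_subset G I && (I \subset A)].
  by exists set0; rewrite /= free_subset0 sub0set.
case/maxsetP => /= /andP[fI sIA] maxI.
apply: leq_trans (_ : #|I| <= _); last first.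
  by apply: (bigmax_sup I); rewrite // inE fI.
case/andP: (fI) => _ /eqP <-; rewrite mxrankS //; apply/spanP => x Ax.
apply/negPn/negP => fx; case/negP: (fx); apply: span_sup.
rewrite -(maxI (x |: I)) ?setU11 ?subsetUr //.
by rewrite free_subsetU1 ?(subsetP sAG) // subUset sub1set Ax.
Qed.

End VectorMatroid.
Arguments spanP {K T m f A n M}.

(** * Rank of the incidence vectors of a graph *)

Section ComponentRank.
Variables (K : fieldType) (T : finType).
Implicit Types (A : {set T}) (x y : T).
Local Open Scope ring_scope.

Definition ind A : 'rV[K]_#|T| := \row_i (enum_val i \in A)%:R.

Lemma ind_sum A : ind A = \sum_(x in A) ind [set x].
Proof.
apply/rowP => i; rewrite summxE mxE.
have [Ai|Ai] := boolP (enum_val i \in A).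
  rewrite (bigD1 _ Ai) /= mxE set11 big1 ?addr0 // => x /andP[_ nex].
  by rewrite mxE inE eq_sym (negPf nex).
rewrite big1 // => x Ax; rewrite mxE inE.
by case: eqP Ai => [->|//]; rewrite Ax.
Qed.

Lemma ind1 i : ind [set enum_val i] = delta_mx 0 i.
Proof. by apply/rowP => j; rewrite !mxE inE (inj_eq enum_val_inj). Qed.

(** The singletons of [A] and of its complement together span a space of dimension [#|T|], so
    neither family can fall short of its cardinality. *)
Lemma rank_basis A : \rank (span (fun x => ind [set x]) A) = #|A|.
Proof.
apply/eqP; rewrite eqn_leq rank_span_le -(leq_add2r #|~: A|) cardsC.
apply: leq_trans (_ : \rank (1%:M : 'M[K]_#|T|) <= _)%N.
  by rewrite mxrank1.
apply: leq_trans (leq_add (leqnn _) (rank_span_le (fun x => ind [set x]) _)).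
apply: leq_trans (mxrank_adds_leqif _ _); rewrite mxrankS //.
apply: submx_trans (_ : span (fun x => ind [set x]) (A :|: ~: A) <= _)%MS.
  rewrite setUCr; apply/row_subP => i; rewrite row1 -ind1.
  exact: (@span_sup _ _ _ (fun x => ind [set x])).
by rewrite spanU.
Qed.

Variable e : rel T.
Hypothesis sym_e : connect_sym e.

(** A row of the signed incidence matrix. *)
Definition edge_vec (p : T * T) := ind [set p.1] - ind [set p.2].

Definition edge_span := span edge_vec [set p | e p.1 p.2].

Lemma edge_span_sup x y : e x y -> (ind [set x] - ind [set y] <= edge_span)%MS.
Proof.
move=> exy; have /(span_sup edge_vec) // : (x, y) \in [set p | e p.1 p.2].
by rewrite inE.
Qed.

Lemma edge_span_connect x y :
  connect e x y -> (ind [set x] - ind [set y] <= edge_span)%MS.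
Proof.
case/connectP => p; elim: p x => [|z p IHp] x /= => [_ ->|].
  by rewrite subrr sub0mx.
case/andP => exz /IHp{}IHp /IHp zy.
rewrite -(subrK (ind [set z]) (ind _)) -addrA.
exact: addmx_sub (edge_span_sup exz) zy.
Qed.

Let Phi : 'M[K]_#|T| :=
  \matrix_(i < #|T|) ind [set fingraph.root e (enum_val i)].

Let ind_Phi x : ind [set x] *m Phi = ind [set fingraph.root e x].
Proof. by rewrite -{1}(enum_rankK x) ind1 -rowE rowK enum_rankK. Qed.

(* [Phi] sends each point to the root of its component, so its rank is the
   number of components and its kernel is [edge_span]. *)
Lemma rank_edge_span : (\rank edge_span + n_comp e T = #|T|)%N.
Proof.
have -> : n_comp e T = \rank Phi.
  rewrite -[LHS]cardsE -rank_basis; apply/eqmx_rank/andP; split.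
    apply/spanP => x; rewrite inE => /andP[/eqP rx _].
    by rewrite -rx -ind_Phi submxMl.
  apply/row_subP => i; rewrite rowK.
  by apply: (@span_sup _ _ _ (fun x => ind [set x])); rewrite !inE roots_root.
suff -> : \rank edge_span = \rank (kermx Phi).
  by rewrite mxrank_ker subnK ?rank_leq_row.
apply/eqmx_rank/andP; split.
  apply/spanP => -[x y]; rewrite inE /= => exy; apply/sub_kermxP.
  rewrite /edge_vec mulmxBl !ind_Phi /=.
  by rewrite (fingraph.rootP sym_e (connect1 exy)) subrr.
(* A vector killed by [Phi] equals its product with [1%:M - Phi], whose rows are differences between
   a point and its root. *)
have sub1Phi : (1%:M - Phi <= edge_span)%MS.
  apply/row_subP => i; rewrite linearB /= row1 rowK -ind1.
  by rewrite edge_span_connect ?connect_root.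
apply: submx_trans (_ : kermx Phi *m (1%:M - Phi) <= _)%MS.
  by rewrite mulmxBr mulmx_ker mulmx1 subr0.
exact: submx_trans (submxMl _ _) sub1Phi.
Qed.

End ComponentRank.

(** [cokermx A] is the quotient map by the row space of [A], so the first term is the rank of [B]
    modulo [A]. Rank-nullity on [A + B], where the kernel of this map is [A], gives the sum. *)
Lemma rank_mul_cokermx (K : fieldType) (m n p : nat)
    (A : 'M[K]_(m, n)) (B : 'M_(p, n)) :
  \rank (B *m cokermx A)%R + \rank A = \rank (A + B).
Proof.
have kA : (kermx (cokermx A) :=: A)%MS.
  apply/eqmxP; rewrite submxE mulmx_ker eqxx /=.
  by apply/sub_kermxP; rewrite mulmx_coker.
rewrite -(mxrank_mul_ker (A + B)%MS (cokermx A)) addsmxMr mulmx_coker.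
rewrite adds0mx; congr (_ + _); apply/esym/eqmx_rank/andP; split.
  by rewrite -kA capmxSr.
by rewrite sub_capmx addsmxSl kA submx_refl.
Qed.

Lemma span_mulmx (K : fieldType) (T : finType) (m : nat) (f : T -> 'rV[K]_m)
    (C : 'M_m) (S : {set T}) :
  (span (fun x => f x *m C)%R S :=: (span f S *m C)%R)%MS.
Proof.
rewrite /span; apply: eqmx_sym; apply: eqmx_trans (sumsmxMr _ _ _) _.
apply: eqmx_sums => x _; apply: eqmx_trans (eqmxMr _ (genmxE _)) _.
exact: eqmx_sym (genmxE _).
Qed.

(** * The annihilator of the cycle space and the transition matroid *)

Section TransitionSpace.
Variables (K : fieldType) (F : graph).
Implicit Types (v : vertex F) (h g : half_edge F).
Implicit Types (p q : {set half_edge F}) (T : {set {set half_edge F}}).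
Implicit Types (S : {set {set {set half_edge F}}}).
Local Open Scope ring_scope.

Local Notation indK := (ind K).

(** A function on half-edges is orthogonal to all these rows exactly when it is twin-invariant. *)
Definition twin_diff : 'M[K]_#|half_edge F| :=
  \matrix_(i < #|half_edge F|)
    (indK [set enum_val i] - indK [set twin (enum_val i)]).

Lemma ind_twin_diff p : indK p *m twin_diff = indK p - indK (twin @^-1: p).
Proof.
have indM1 h : indK [set h] *m twin_diff = indK [set h] - indK [set twin h].
  by rewrite -{1}(enum_rankK h) ind1 -rowE rowK enum_rankK.
rewrite ind_sum mulmx_suml (eq_bigr _ (fun h _ => indM1 h)) big_split /=.
congr (_ + _); rewrite sumrN; congr (- _).
rewrite [RHS]ind_sum (reindex_inj (can_inj (@twinK F))) /=.
by apply: eq_big => h; rewrite ?inE // twinK.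
Qed.

Lemma edge_span_twin : (edge_span K (frel (@twin F)) :=: twin_diff)%MS.
Proof.
apply/eqmxP/andP; split.
  apply/spanP => -[h g]; rewrite inE /= => /eqP <-.
  have := row_sub (enum_rank h) twin_diff.
  by rewrite rowK enum_rankK.
by apply/row_subP => i; rewrite rowK edge_span_sup /=.
Qed.

Definition star_mx : 'M[K]_(#|vertex F|, #|half_edge F|) :=
  \matrix_(i < #|vertex F|) indK (star (enum_val i)).

(** Column [h] of the product is the signed incidence vector of the edge of [h], so the transpose
    has the row space [edge_span] of [adj]. *)
Lemma rank_star_twin_diff :
  (\rank (star_mx *m twin_diff) + num_components F = #|vertex F|)%N.
Proof.
rewrite -[RHS](@rank_edge_span K _ (@adj F)); last first.
  exact/sym_connect_sym/adj_sym.
congr (_ + _)%N; rewrite -mxrank_tr; apply/eqmx_rank/andP.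
have rowE h : row (enum_rank h) (star_mx *m twin_diff)^T
    = indK [set inc h] - indK [set inc (twin h)].
  have rT m n (M : 'M[K]_(m, n)) i j : row i M^T 0 j = row j M 0 i.
    by rewrite !mxE.
  apply/rowP => j; rewrite rT.
  rewrite row_mul rowK ind_twin_diff !mxE !inE enum_rankK.
  by rewrite !(eq_sym _ (enum_val j)).
split.
  apply/row_subP => i; rewrite -(enum_valK i) rowE edge_span_sup //.
  by apply/existsP; exists (enum_val i); rewrite !eqxx.
apply/spanP => -[u v]; rewrite inE /= => /existsP[h /andP[/eqP<- /eqP<-]].
by rewrite /edge_vec /= -rowE row_sub.
Qed.

Hypothesis K2 : 2%N \in [pchar K].
Hypothesis hF : four_regular F.

Lemma card_half_edge : #|half_edge F| = (4 * #|vertex F|)%N.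
Proof.
rewrite -sum1_card (partition_big (@inc F) xpredT) //=.
rewrite (eq_bigr (fun=> 4%N)) ?sum_nat_const ?[(_ * 4)%N]mulnC // => v _.
by rewrite -(hF v) -sum1_card; apply: eq_bigl => h; rewrite inE.
Qed.

(** [twin] has no fixed point, so its orbits group the [4n] half-edges into [2n] components. *)
Lemma rank_twin_diff : \rank twin_diff = (2 * #|vertex F|)%N.
Proof.
have twinI := can_inj (@twinK F).
have := rank_edge_span K (fconnect_sym twinI).
rewrite edge_span_twin => rk.
have : (fcard (@twin F) (half_edge F) * 2 = #|half_edge F|)%N.
  rewrite (fcard_order_set twinI) //.
  apply/subsetP => h _; rewrite inE /=; apply/eqP.
  apply: (@order_cycle _ _ [:: h; twin h]); rewrite ?inE ?eqxx //=.
    by rewrite !eqxx twinK eqxx.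
  by rewrite !inE eq_sym twin_neq.
move: rk card_half_edge; lia.
Qed.

(* In characteristic 2, [twin_diff] squares to zero; equality is then a matter
   of dimension. *)
Lemma ker_twin_diff : (kermx twin_diff :=: twin_diff)%MS.
Proof.
have sDk : (twin_diff <= kermx twin_diff)%MS.
  apply/sub_kermxP/row_matrixP => i; rewrite row_mul rowK linear0 mulmxBl.
  rewrite !ind_twin_diff.
  have -> : twin @^-1: [set enum_val i] = [set twin (enum_val i)].
    by apply/setP => h; rewrite !inE (can2_eq (@twinK F) (@twinK F)).
  have -> : twin @^-1: [set twin (enum_val i)] = [set enum_val i].
    by apply/setP => h; rewrite !inE (inj_eq (can_inj (@twinK F))).
  rewrite opprB; apply/rowP => j; rewrite !mxE; exact: addrr_pchar2.
apply/eqmx_sym/eqmxP; rewrite -(geq_leqif (mxrank_leqif_eq sDk)).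
by rewrite mxrank_ker rank_twin_diff; move: card_half_edge; lia.
Qed.

(* The annihilator of the cycle space. *)
Definition boundary_space : 'M[K]_#|half_edge F| :=
  (twin_diff + <<star_mx>>)%MS.

(** Rank-nullity for [twin_diff] on this space: the kernel is [twin_diff] itself, of rank [2n], and
    the image is that of the stars, of rank [n - c(F)]. *)
Lemma rank_boundary_space :
  (\rank boundary_space + num_components F = 3 * #|vertex F|)%N.
Proof.
rewrite -(mxrank_mul_ker boundary_space twin_diff).
have -> : \rank (boundary_space :&: kermx twin_diff) = \rank twin_diff.
  rewrite (cap_eqmx (eqmx_refl _) ker_twin_diff).
  by apply/eqmx_rank/andP; rewrite capmxSr sub_capmx addsmxSl submx_refl.
have -> : \rank (boundary_space *m twin_diff) = \rank (star_mx *m twin_diff).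
  rewrite addsmxMr; have -> : twin_diff *m twin_diff = 0.
    by apply/sub_kermxP; rewrite ker_twin_diff.
  by rewrite adds0mx (eqmxMr _ (genmxE _)).
by rewrite addnAC rank_star_twin_diff rank_twin_diff -mulSn.
Qed.

Lemma ind_setU p q : [disjoint p & q] -> indK (p :|: q) = indK p + indK q.
Proof.
move=> dpq; apply/rowP => i; rewrite !mxE inE.
have [pi|_] := boolP (enum_val i \in p); last by rewrite add0r.
by rewrite (disjointFr dpq pi) addr0.
Qed.

(** Signs vanish in characteristic 2; the difference form makes a pair an edge vector. *)
Lemma ind_pair h g : h != g -> indK [set h; g] = indK [set h] - indK [set g].
Proof.
move=> nehg; rewrite ind_setU; last by rewrite disjoints1 inE.
by congr (_ + _); apply/rowP => i; rewrite !mxE oppr_pchar2.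
Qed.

(* The two pairs of a transition have the indicator of a star as their sum, so
   modulo [boundary_space] the picked pair does not matter. *)
Definition transition_vec T : 'rV[K]_#|half_edge F| :=
  if [pick p in T] is Some p then indK p else 0.

Lemma transition_atP v T : T \in transitions_at v ->
  exists p q, [/\ T = [set p; q], #|p| = 2, #|q| = 2,
    [disjoint p & q] & p :|: q = star v].
Proof.
rewrite inE => /andP[parT /forall_inP T2].
have cT : #|T| = 2.
  have := card_partition parT.
  rewrite (eq_bigr (fun=> 2%N)) => [|p /T2/eqP //].
  by rewrite hF sum_nat_const; lia.
have /cards2P[p [q [nepq TE]]] : #|T| == 2 by rewrite cT.
have [/eqP covT /trivIsetP tT _] := and3P parT.
have Tp : p \in T by rewrite TE !inE eqxx.
have Tq : q \in T by rewrite TE !inE eqxx orbT.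
exists p, q; split=> //; [exact/eqP/(T2 p) | exact/eqP/(T2 q) | exact: tT |].
by rewrite -covT /cover TE big_setU1 ?big_set1 ?inE.
Qed.

Definition transition_rel S : rel (half_edge F) := fun h g =>
  (twin h == g) || [exists T in S, exists p in T, (h \in p) && (g \in p)].

Lemma transition_rel_sym S : connect_sym (transition_rel S).
Proof.
apply/sym_connect_sym => h g; rewrite /transition_rel.
congr (_ || _); first by rewrite (can2_eq (@twinK F) (@twinK F)) eq_sym.
apply: eq_existsb => T; congr (_ && _); apply: eq_existsb => p.
by congr (_ && _); apply: andbC.
Qed.

Lemma transition_pairP S h g : reflect (exists2 T, T \in S &
    exists2 p, p \in T & (h \in p) && (g \in p))
  [exists T in S, exists p in T, (h \in p) && (g \in p)].
Proof.
apply: (iffP exists_inP) => -[T ST] => [/exists_inP|] [p Tp hgp];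
  exists T => //; first by exists p.
by apply/exists_inP; exists p.
Qed.

(** Both spaces contain the twin differences and all pairs of transitions in [S]. On the left, the
    pair not picked is the star minus the picked one. On the right, a star is the sum of the two
    pairs of the transition that [S] has at its vertex. *)
Lemma boundary_transition_span S :
    S \subset transitions F ->
    (forall v, exists2 T, T \in S & T \in transitions_at v) ->
  (boundary_space + span transition_vec S
     :=: edge_span K (transition_rel S))%MS.
Proof.
move=> /subsetP sST fullS; set M := (_ + _)%MS; set E := edge_span _ _.
have subtM : (twin_diff <= M)%MS.
  exact: submx_trans (addsmxSl _ _) (addsmxSl _ _).
have starM v : (indK (star v) <= M)%MS.
  apply: submx_trans (addsmxSl _ _); apply: submx_trans (addsmxSr _ _).
  by have := row_sub (enum_rank v) star_mx; rewrite rowK enum_rankK genmxE.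
have passM T p : T \in S -> p \in T -> (indK p <= M)%MS.
  move=> ST; have /bigcupP[v _ Tv] := sST T ST.
  have := submx_trans (span_sup transition_vec ST) (addsmxSr boundary_space _).
  have [q [r [TE _ _ dqr qrE]]] := transition_atP Tv.
  have := starM v; rewrite -qrE ind_setU // -/M => sM.
  rewrite /transition_vec; case: pickP => [s|/(_ q)]; last first.
    by rewrite TE !inE eqxx.
  rewrite TE !inE => /orP[] /eqP -> xM /orP[] /eqP -> //.
    by rewrite -[indK r](addKr (indK q)) addmx_sub // eqmx_opp.
  by rewrite -[indK q](addrK (indK r)) addmx_sub // eqmx_opp.
have passE T p : T \in S -> p \in T -> (indK p <= E)%MS.
  move=> ST Tp; have /bigcupP[v _ Tv] := sST T ST.
  have /cards2P[h [g [nehg pE]]] : #|p| == 2.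
    have [q [r [TE q2 r2 _ _]]] := transition_atP Tv.
    by move: Tp; rewrite TE !inE => /orP[] /eqP ->; apply/eqP.
  rewrite pE ind_pair // edge_span_sup // /transition_rel.
  apply/orP; right; apply/transition_pairP.
  by exists T => //; exists p; rewrite // pE !inE !eqxx orbT.
apply/eqmxP/andP; split; last first.
  apply/spanP => -[h g]; rewrite inE /= => /orP[hg|].
    apply: submx_trans subtM; rewrite -edge_span_twin.
    exact: edge_span_sup.
  case/transition_pairP => T ST [p Tp /andP[hp gp]].
  have [<-|nehg] := eqVneq h g; first by rewrite /edge_vec subrr sub0mx.
  rewrite /edge_vec /= -ind_pair //.
  suff -> : [set h; g] = p by apply: passM Tp.
  have /bigcupP[v _ Tv] := sST T ST.
  apply/eqP; rewrite eqEcard subUset !sub1set hp gp cards2 nehg /=.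
  have [q [r [TE q2 r2 _ _]]] := transition_atP Tv.
  by move: Tp; rewrite TE !inE => /orP[] /eqP ->; rewrite ?q2 ?r2.
rewrite !addsmx_sub genmxE; apply/andP; split; first (apply/andP; split).
- rewrite -edge_span_twin; apply/spanP => -[h g]; rewrite inE /= => hg.
  by apply: edge_span_sup; rewrite /transition_rel hg.
- apply/row_subP => i; rewrite rowK.
  have [T ST Tv] := fullS (enum_val i).
  have [q [r [TE _ _ dqr <-]]] := transition_atP Tv.
  by rewrite ind_setU // addmx_sub // (passE T) // TE !inE eqxx ?orbT.
apply/spanP => T ST; rewrite /transition_vec.
by case: pickP => [p Tp|_]; [apply: passE Tp | rewrite sub0mx].
Qed.

(** Multiplying by [cokermx boundary_space] turns row vectors into functionals on the cycle
    space. *)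
Definition transition_matroid : matroid {set {set half_edge F}} :=
  vector_matroid (fun T => transition_vec T *m cokermx boundary_space)
    (transitions F).

(** Modulo [boundary_space] the rank is a difference of two ranks: with [k] components it is
    [(4n - k) - (3n - c(F))]. *)
Lemma mrank_transition_matroid S :
    S \subset transitions F ->
    (forall v, exists2 T, T \in S & T \in transitions_at v) ->
  (mrank transition_matroid S + n_comp (transition_rel S) (half_edge F)
     = #|vertex F| + num_components F)%N.
Proof.
move=> sST fullS; rewrite mrank_vector_matroid // span_mulmx.
have rkS := rank_mul_cokermx boundary_space (span transition_vec S).
rewrite (boundary_transition_span sST fullS) in rkS.
have arith (n c h a b r k : nat) : (r + a = b -> b + k = h -> h = 4 * n ->
  a + c = 3 * n -> r + k = n + c)%N by lia.
exact: arith rkS (rank_edge_span K (transition_rel_sym S)) card_half_edge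
  rank_boundary_space.
Qed.

End TransitionSpace.

(** * Components of the transition relations *)

Section TransitionComponents.
Variable F : graph.
Implicit Types (v : vertex F) (h g : half_edge F) (s : seq (half_edge F)).
Implicit Types (p q : {set half_edge F}) (T : {set {set half_edge F}}).
Hypothesis hF : four_regular F.

Lemma pair_in_transition v h g :
  inc h = v -> inc g = v -> h != g ->
  [set [set h; g]; star v :\: [set h; g]] \in transitions_at v.
Proof.
move=> hv gv nehg; set p := [set h; g]; set q := _ :\: _.
have p2 : #|p| = 2 by rewrite cards2 nehg.
have spv : p \subset star v by rewrite subUset !sub1set !inE hv gv eqxx.
have q2 : #|q| = 2 by rewrite cardsD (setIidPr spv) hF p2.
have dpq : [disjoint p & q] by rewrite -setI_eq0 /q setDE setICA setICr setI0.
have nepq : p != q.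
  by apply: contraTneq dpq => ->; rewrite -setI_eq0 setIid -card_gt0 q2.
rewrite inE; apply/andP; split; last first.
  by apply/forall_inP => r; rewrite !inE => /orP[] /eqP ->; apply/eqP.
apply/and3P; split.
- rewrite /cover big_setU1 ?inE //= big_set1 setUC /q setDE setUIl.
  by rewrite (setUidPl spv) setUC setUCr setIT.
- apply/trivIsetP => r t; rewrite !inE => /orP[] /eqP -> /orP[] /eqP ->;
    by rewrite ?eqxx // disjoint_sym.
by rewrite !inE negb_or ![set0 == _]eq_sym -!card_gt0 p2 q2.
Qed.

Lemma exists_transition v :
  exists2 T, T \in transitions F & T \in transitions_at v.
Proof.
have /card_gt1P[h [g [hv gv nehg]]] : 1 < #|star v| by rewrite hF.
rewrite !inE in hv gv.
have Tv := pair_in_transition (eqP hv) (eqP gv) nehg.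
by move: Tv; set T := [set _; _] => Tv; exists T => //; apply/bigcupP; exists v.
Qed.

(** [inc] matches the components on both sides: all transitions together join any two half-edges of
    a star, and twin steps follow the edges. *)
Lemma n_comp_transitions :
  n_comp (transition_rel (transitions F)) (half_edge F) = num_components F.
Proof.
have symT := transition_rel_sym (transitions F).
have sym_adj : connect_sym (@adj F) by apply/sym_connect_sym/adj_sym.
rewrite /num_components (@adjunction_n_comp _ _ (@inc F) _ _ sym_adj symT) //.
have star_connect h g :
    inc h = inc g -> connect (transition_rel (transitions F)) h g.
  move=> hg; have [->//|nehg] := eqVneq h g; apply/connect1/orP; right.
  have Tv := pair_in_transition hg (erefl _) nehg.
  set T := [set _; _] in Tv.
  apply/transition_pairP; exists T; first by apply/bigcupP; exists (inc g).
  by exists [set h; g]; rewrite ?inE ?eqxx ?orbT.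
split=> [v _ | h g _].
  apply: sigW.
  have /card_gt0P[h] : 0 < #|star v| by rewrite hF.
  by rewrite inE => /eqP <-; exists h.
apply/idP/idP.
  case/connectP => t; elim: t h => [|k t IHt] h /= => [_ ->//|].
  case/andP => hk /IHt{}IHt /IHt; apply: connect_trans.
  case/orP: hk => [/eqP<-|].
    by apply/connect1/existsP; exists h; rewrite !eqxx.
  case/transition_pairP => T /bigcupP[v _ Tv] [p Tp /andP[hp kp]].
  rewrite inE in Tv; case/andP: Tv => /cover_partition covT _.
  have inc_v l : l \in p -> inc l = v.
    move=> lp; suff: l \in star v by rewrite inE => /eqP.
    by rewrite -covT; apply/bigcupP; exists p.
  by rewrite !inc_v.
case/connectP => t.
elim: t h => [|v t IHt] h /= => [_ hg|]; first exact: star_connect.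
(* To follow the edge of [k], first move from [h] to [k] within their common star. *)
case/andP => /existsP[k /andP[/eqP kh /eqP kv]]; rewrite -kv => /IHt{}IHt /IHt.
apply: connect_trans; apply: connect_trans (star_connect _ _ (esym kh)) _.
by apply/connect1/orP; left.
Qed.

(* The passage of [s] containing [h], when [s] is a circuit through [h] or
   [twin h]. *)
Definition seq_passage s h : {set half_edge F} :=
  if h \in s then [set twin (prev s h); h] else [set h; next s (twin h)].

Lemma mem_map_twin s h : (h \in map twin s) = (twin h \in s).
Proof. by rewrite -{1}(twinK h) (mem_map (can_inj (@twinK F))). Qed.

Lemma mem_seq_edges s h :
  (edge_of h \in seq_edges s) = (h \in s ++ map twin s).
Proof.
rewrite mem_cat mem_map_twin; apply/imsetP/orP => [[g gs eqhg]|[hs|hs]].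
- have : h \in edge_of g by rewrite -eqhg !inE eqxx.
  by rewrite !inE => /orP[] /eqP ->; rewrite ?twinK; [left|right].
- by exists h.
by exists (twin h); rewrite // /edge_of twinK setUC.
Qed.

(** * Passages of a single circuit *)

Section Circuit.
Variable s : seq (half_edge F).
Hypothesis circ_s : is_circuit s.

Let Us : uniq s.
Proof. by case/and3P: circ_s => _ _; rewrite cat_uniq => /and3P[]. Qed.

Lemma circuit_twin_notin h : h \in s -> twin h \notin s.
Proof.
case/and3P: circ_s => _ _; rewrite cat_uniq => /and3P[_ /hasPn tw _] hs.
by apply: tw; rewrite map_f.
Qed.

Lemma circuit_inc_next h : h \in s -> inc (next s h) = inc (twin h).
Proof. by case/and3P: circ_s => _ cs _ hs; apply/esym/eqP/(next_cycle cs). Qed.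

(** A passage is determined by either of its half-edges: one in [s] leaves the vertex, one whose
    twin is in [s] enters it, and no half-edge does both. *)
Lemma seq_passages_mem p h : p \in seq_passages s -> h \in p ->
  (h \in s ++ map twin s) && (p == seq_passage s h).
Proof.
case/imsetP => g gs ->; rewrite mem_cat mem_map_twin /seq_passage.
rewrite !inE => /orP[] /eqP ->.
  by rewrite (negPf (circuit_twin_notin gs)) !twinK gs eqxx.
by rewrite mem_next gs prev_next // eqxx.
Qed.

Lemma seq_passage_passages h : h \in s ++ map twin s ->
  seq_passage s h \in seq_passages s /\ h \in seq_passage s h.
Proof.
rewrite mem_cat mem_map_twin /seq_passage; case: ifP => [hs _|_ /= hs].
  split; last by rewrite !inE eqxx orbT.
  by apply/imsetP; exists (prev s h); rewrite ?mem_prev ?next_prev.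
split; last by rewrite !inE eqxx.
by apply/imsetP; exists (twin h); rewrite ?twinK.
Qed.

Lemma card_seq_passages p : p \in seq_passages s -> #|p| = 2.
Proof.
case/imsetP => g gs ->; rewrite cards2.
case: eqP => // eg; have := circuit_twin_notin gs.
by rewrite eg mem_next gs.
Qed.

Lemma seq_passages_star p h :
  p \in seq_passages s -> h \in p -> p \subset star (inc h).
Proof.
case/imsetP => g gs -> hp; rewrite subUset !sub1set !inE.
move: hp; rewrite !inE => /orP[] /eqP ->;
  by rewrite (circuit_inc_next gs) eqxx.
Qed.

(** Going from [h] to [next s h] crosses an edge by [twin] and then a passage; iterating [next]
    reaches all of [s], and the other half-edges are twins of these. *)
Lemma circuit_connect (e : rel (half_edge F)) :
    connect_sym e -> (forall h, connect e h (twin h)) ->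
    (forall p h g, p \in seq_passages s -> h \in p -> g \in p ->
       connect e h g) ->
  {in s ++ map twin s &, forall h g, connect e h g}.
Proof.
move=> sym_e e_twin e_pass.
have s_conn : {in s &, forall h g, connect e h g}.
  move=> h g hs gs.
  have /iter_findex <- : fconnect (next s) h g.
    by rewrite (fconnect_cycle (cycle_next Us)).
  elim: (findex _ _ _) => //= n IHn; apply: connect_trans IHn _.
  set k := iter n _ h; have ks : k \in s.
    by rewrite /k; elim: (n) => //= j; rewrite mem_next.
  apply: connect_trans (e_twin k) _.
  have kp : [set twin k; next s k] \in seq_passages s by apply/imsetP; exists k.
  by apply: e_pass kp _ _; rewrite !inE eqxx ?orbT.
have conn_s h : h \in s ++ map twin s -> exists2 k, k \in s & connect e h k.
  rewrite mem_cat mem_map_twin => /orP[] hs; first by exists h.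
  by exists (twin h).
move=> h g /conn_s[k ks hk] /conn_s[l ls gl].
apply: connect_trans hk _; rewrite sym_e; apply: connect_trans gl _.
exact: s_conn.
Qed.

End Circuit.

(** * Circuit partitions and the transitions they use *)

Section CircuitPartition.
Variable P : {set circuit F}.
Hypothesis partP : circuit_partition P.
Implicit Types C D : circuit F.

Lemma circuit_repr C : is_circuit (val (repr C) : seq _).
Proof. exact: (svalP (repr C)). Qed.

Definition half_edges_of C : seq (half_edge F) :=
  let s := val (repr C) : seq _ in s ++ map twin s.

Definition circuit_through h : option (circuit F) :=
  [pick C in P | h \in half_edges_of C].

(** Edge-disjointness allows at most one circuit of [P] through [h], so [pick] has no choice. *)
Lemma circuit_throughP h C :
  reflect (C \in P /\ h \in half_edges_of C) (circuit_through h == Some C).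
Proof.
have [_ disjP] := partP.
have inj D D' : D \in P -> D' \in P -> h \in half_edges_of D ->
    h \in half_edges_of D' -> D = D'.
  move=> PD PD' hD hD'; apply/eqP; apply: contraT => neDD'.
  have /disjoint_setI0 := disjP D D' PD PD' neDD'; move/setP/(_ (edge_of h)).
  by rewrite !inE !mem_seq_edges -!/(half_edges_of _) hD hD'.
rewrite /circuit_through; case: pickP => [D /andP[PD hD]|noC].
  apply: (iffP eqP) => [[<-//]|[PC hC]].
  by rewrite (inj D C).
by right=> -[PC hC]; have := noC C; rewrite PC hC.
Qed.

Lemma circuit_through_ex h : exists C, circuit_through h == Some C.
Proof.
have [/and3P[/eqP covE _ _] _] := partP.
have : edge_of h \in cover [set circuit_edges C | C in P].
  by rewrite covE imset_f.
case/bigcupP => _ /imsetP[C PC ->]; rewrite mem_seq_edges => hC.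
by exists C; apply/circuit_throughP.
Qed.

Lemma transition_usedP p v : p \in transition_used P v ->
  exists C, [/\ C \in P, p \in circuit_passages C & p \subset star v].
Proof. by rewrite inE => /andP[/bigcupP[C PC Cp] pv]; exists C. Qed.

Lemma transition_used_mem p v h : p \in transition_used P v -> h \in p ->
  exists2 C, circuit_through h == Some C & p = seq_passage (val (repr C)) h.
Proof.
case/transition_usedP => C [PC Cp _] hp.
have /andP[hC /eqP pE] := seq_passages_mem (circuit_repr C) Cp hp.
by exists C => //; apply/circuit_throughP.
Qed.

Lemma transition_used_ex C p h : C \in P -> p \in circuit_passages C ->
  h \in p -> p \in transition_used P (inc h).
Proof.
move=> PC Cp hp; rewrite inE; apply/andP; split.
  by apply/bigcupP; exists C.
exact: (seq_passages_star (circuit_repr C) Cp hp).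
Qed.

(** The pairs cover the star because every half-edge is on a circuit of [P]; they are disjoint
    because a half-edge determines its circuit and then its passage. *)
Lemma transition_used_at v : transition_used P v \in transitions_at v.
Proof.
have card2 p : p \in transition_used P v -> #|p| = 2.
  case/transition_usedP => C [_ Cp _].
  exact: card_seq_passages (circuit_repr C) _ Cp.
rewrite inE; apply/andP; split; last by apply/forall_inP => p /card2 ->.
apply/and3P; split.
- rewrite eqEsubset; apply/andP; split.
    by apply/bigcupsP => p /transition_usedP[C []].
  apply/subsetP => h; rewrite inE => /eqP <-.
  have [C /circuit_throughP[PC hC]] := circuit_through_ex h.
  have [Cp hp] := seq_passage_passages (circuit_repr C) hC.
  apply/bigcupP; exists (seq_passage (val (repr C)) h) => //.
  exact: transition_used_ex Cp hp.
- apply/trivIsetP => p q vp vq; apply: contraR => /pred0Pn[h /andP[/= hp hq]].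
  have [C /eqP hC ->] := transition_used_mem vp hp.
  by have [D] := transition_used_mem vq hq; rewrite hC => /eqP[<-] ->.
by apply/negP => /card2; rewrite cards0.
Qed.

Lemma tau_sub_transitions : tau P \subset transitions F.
Proof.
apply/subsetP => _ /imsetP[v _ ->]; apply/bigcupP.
by exists v => //; apply: transition_used_at.
Qed.

(** [circuit_through] is constant along the relation, and half-edges of one circuit are connected,
    so components correspond to circuits. *)
Lemma n_comp_tau :
  n_comp (transition_rel (tau P)) (half_edge F) = #|P|.
Proof.
have symT := transition_rel_sym (tau P).
(* Under equality every value is its own component. *)
pose eqo : rel (option (circuit F)) := eq_op.
have conn_eqo x y : connect eqo x y = (x == y).
  apply/idP/eqP => [/connectP[t]|->//].
  by elim: t x => [|z t IHt] x /= => [_ ->//|/andP[/eqP -> /IHt]].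
have sym_eqo : connect_sym eqo by move=> x y; rewrite !conn_eqo eq_sym.
pose a := [set Some C | C in P].
have -> : #|P| = n_comp eqo a.
  have SomeI : injective (@Some (circuit F)) by move=> ? ? [].
  rewrite -(card_imset _ SomeI); apply: eq_card => x.
  rewrite -[RHS]/((fingraph.root eqo x == x) && (x \in a)).
  by rewrite eq_sym -conn_eqo connect_root.
rewrite (@adjunction_n_comp _ _ circuit_through eqo _ sym_eqo symT).
- apply: eq_n_comp_r => h; rewrite !inE.
  have [C Ch] := circuit_through_ex h; have [PC _] := circuit_throughP h C Ch.
  by rewrite (eqP Ch) imset_f.
- by move=> x y /eqP ->.
split=> [x ax|h g _].
  apply: sigW; case/imsetP: ax => C PC ->.
  (* Circuits are nonempty, so [circuit_through] hits each of them. *)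
  have : half_edges_of C != [::].
    rewrite /half_edges_of; have /and3P[] := circuit_repr C.
    by case: (\val (repr C) : seq _).
  case E: (half_edges_of C) => [//|h t] _; exists h.
  rewrite conn_eqo eq_sym; apply/circuit_throughP.
  by rewrite E mem_head.
rewrite conn_eqo; apply/idP/idP.
  case/connectP => t; elim: t h => [|k t IHt] h /= => [_ ->//|].
  case/andP => hk /IHt{}IHt /IHt /eqP <-.
  have [C Ch] := circuit_through_ex h; have [PC hC] := circuit_throughP h C Ch.
  rewrite (eqP Ch) eq_sym; apply/circuit_throughP; split=> //.
  case/orP: hk => [/eqP<-|].
    by move: hC; rewrite !mem_cat !mem_map_twin twinK orbC.
  case/transition_pairP => T /imsetP[v _ ->] [p vp /andP[hp kp]].
  (* The pair is a passage of some [D] in [P]; [h] lies on both [C] and [D], so they agree. *)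
  have [D [PD Dp _]] := transition_usedP vp.
  have /andP[hD _] := seq_passages_mem (circuit_repr D) Dp hp.
  have /andP[kD _] := seq_passages_mem (circuit_repr D) Dp kp.
  suff /eqP[->] : Some C == Some D by [].
  by rewrite -(eqP Ch); apply/circuit_throughP.
have [C Cg] := circuit_through_ex g; rewrite (eqP Cg).
case/circuit_throughP => PC hC; have [_ gC] := circuit_throughP g C Cg.
apply: (circuit_connect (circuit_repr C) symT _ _ hC gC) => [k|p k l Cp kp lp].
  by apply/connect1/orP; left.
apply/connect1/orP; right; apply/transition_pairP.
exists (transition_used P (inc k)); first exact: imset_f.
by exists p; rewrite ?kp // (transition_used_ex PC Cp kp).
Qed.

End CircuitPartition.
End TransitionComponents.

Theorem theorem1 (F : graph) (hF : four_regular F) :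
  exists M : matroid {set {set half_edge F}},
    [/\ ground M = transitions F,
        mrank M (ground M) = #|vertex F|
      & forall P : {set circuit F}, circuit_partition P ->
          ((mrank M (tau P))%:Z
           = #|vertex F|%:Z + (num_components F)%:Z - #|P|%:Z)%R].
Proof.
have F2 : 2 \in [pchar 'F_2]%R by rewrite pchar_Fp.
have rk := mrank_transition_matroid F2 hF.
exists (transition_matroid 'F_2 F); split=> // [|P partP].
  (* For the set of all transitions the components are those of [F], so [c(F)] cancels. *)
  apply/eqP; rewrite -(eqn_add2r (num_components F)).
  rewrite -(rk _ (subxx _) (exists_transition hF)).
  by rewrite n_comp_transitions.
have := rk _ (tau_sub_transitions partP); rewrite (n_comp_tau partP).
move=> /(_ _)/(congr1 Posz); rewrite !PoszD => <-; first by rewrite addrK.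
move=> v; exists (transition_used P v); first exact: imset_f.
exact: transition_used_at.
Qed.
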